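(* Let $\pi$ be a discrete group with identity $1$ and let $(A,\Delta)$ be a multiplier Hopf $\pi$-coalgebra with counit $\varepsilon:A_1\to\mathbb{C}$. Then there exists an antihomomorphism $S=\{S_\alpha:A_\alpha\to M(A_{\alpha^{-1}})\}_{\alpha\in\pi}$ (i.e. each $S_\alpha$ is linear with $S_\alpha(ab)=S_\alpha(b)S_\alpha(a)$ for $a,b\in A_\alpha$) such that for all $\alpha\in\pi$, $a\in A_1$ and $b,c\in A_\alpha$ $$m_\alpha\Big((I\otimes S_{\alpha^{-1}})\big((c\otimes1)\Delta_{\alpha,\alpha^{-1}}(a)\big)(1\otimes b)\Big)=c\,\varepsilon(a)\,b,$$ $$m_\alpha\Big((c\otimes1)(S_{\alpha^{-1}}\otimes I)\big(\Delta_{\alpha^{-1},\alpha}(a)(1\otimes b)\big)\Big)=c\,\varepsilon(a)\,b .$$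
   Context: Algebras are associative over $\mathbb{C}$, possibly without unit, with nondegenerate product ($ab=0$ for all $a$ implies $b=0$, and $ab=0$ for all $b$ implies $a=0$). The multiplier algebra $M(A)$ consists of pairs $(L,R)$ of linear maps $A\to A$ with $L(ab)=L(a)b$, $R(ab)=aR(b)$, $R(a)b=aL(b)$; for $x=(L,R)$ write $xa=L(a)$, $ax=R(a)$; $A\otimes B\subseteq M(A)\otimes M(B)\subseteq M(A\otimes B)$. $m_\alpha:A_\alpha\otimes A_\alpha\to A_\alpha$ is the multiplication; $I$ is the identity map. Let $A=\{A_\alpha\}_{\alpha\in\pi}$ be a family of such algebras. A comultiplication on $A$ is a family of homomorphisms $\Delta_{\alpha,\beta}:A_{\alpha\beta}\to M(A_\alpha\otimes A_\beta)$ such that for all $\alpha,\beta,\gamma\in\pi$: (1) $\Delta_{\alpha,\beta}(a)(1\otimes b)\in A_\alpha\otimes A_\beta$ for $a\in A_{\alpha\beta}$, $b\in A_\beta$, and $(a\otimes 1)\Delta_{\alpha,\beta}(b)\in A_\alpha\otimes A_\beta$ for $a\in A_\alpha$, $b\in A_{\alpha\beta}$; (2) $(a\otimes1\otimes1)(\Delta_{\alpha,\beta}\otimes I)(\Delta_{\alpha\beta,\gamma}(b)(1\otimes c))=(I\otimes\Delta_{\beta,\gamma})((a\otimes1)\Delta_{\alpha,\beta\gamma}(b))(1\otimes1\otimes c)$ for $a\in A_\alpha$, $b\in A_{\alpha\beta\gamma}$, $c\in A_\gamma$. $(A,\Delta)$ is a multiplier Hopf $\pi$-coalgebra if $\Delta$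 is a comultiplication and the linear maps $T^1_{\alpha,\beta}:A_{\alpha\beta}\otimes A_\beta\to A_\alpha\otimes A_\beta$, $T^1_{\alpha,\beta}(a\otimes b)=\Delta_{\alpha,\beta}(a)(1\otimes b)$, and $T^2_{\alpha,\beta}:A_\alpha\otimes A_{\alpha\beta}\to A_\alpha\otimes A_\beta$, $T^2_{\alpha,\beta}(a\otimes b)=(a\otimes1)\Delta_{\alpha,\beta}(b)$, are bijective for all $\alpha,\beta\in\pi$. The counit of $(A,\Delta)$ is the homomorphism $\varepsilon:A_1\to\mathbb{C}$ (which exists) satisfying $(I\otimes\varepsilon)((a\otimes1)\Delta_{\alpha,1}(b))=ab$ and $(\varepsilon\otimes I)(\Delta_{1,\alpha}(a)(1\otimes b))=ab$ for all $\alpha\in\pi$, $a,b\in A_\alpha$. *)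

(* Defs.v *)
From HB Require Import structures.
From mathcomp Require Import all_boot all_algebra.
From mathcomp Require Import boolp classical_sets functions reals.
From mathcomp Require Import complex freeg.

Set Implicit Arguments.
Unset Strict Implicit.
Unset Printing Implicit Defensive.

Import GRing.Theory.
Import Quotient.

Local Open Scope ring_scope.
Local Open Scope quotient_scope.

(** * Tensor product of vector spaces

    [U ⊗ V] is the free vector space on [U * V] modulo the subspace [tker]
    spanned by the bilinearity relations. *)

Section TensorProduct.
Variables (K : fieldType) (U V : lmodType K).

Inductive tker : {freeg (U * V) / K} -> Prop :=
| tker0 : tker 0
| tkerD x y : tker x -> tker y -> tker (x + y)
| tkerZ k x : tker x -> tker (k *: x)
| tker_Dl u u' v : tker (<< (u + u', v) >> - << (u, v) >> - << (u', v) >>)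
| tker_Dr u v v' : tker (<< (u, v + v') >> - << (u, v) >> - << (u, v') >>)
| tker_Zl k u v : tker (<< (k *: u, v) >> - k *: << (u, v) >>)
| tker_Zr k u v : tker (<< (u, k *: v) >> - k *: << (u, v) >>).

Definition tkerb : {pred {freeg (U * V) / K}} := fun x => `[< tker x >].

Lemma tkerb_submod_closed : submod_closed tkerb.
Proof.
split=> [|k x y /asboolP kx /asboolP ky]; apply/asboolP; first exact: tker0.
exact/tkerD/ky/tkerZ.
Qed.

HB.instance Definition _ :=
  GRing.isSubmodClosed.Build K {freeg (U * V) / K} tkerb tkerb_submod_closed.

Definition tensor : Type := {quot tkerb}.
HB.instance Definition _ := GRing.Zmodule.on tensor.
HB.instance Definition _ := EqQuotient.on tensor.

Local Notation cl := (\pi_tensor : {freeg (U * V) / K} -> tensor).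

Lemma tensor_eqP x y : cl x = cl y <-> tker (x - y).
Proof.
split; first by move/eqP; rewrite -idealrBE => /asboolP.
by move=> h; apply/eqP; rewrite -idealrBE; apply/asboolP.
Qed.

Lemma tensor_piD x y : cl (x + y) = cl x + cl y.
Proof. exact: (pi_add tkerb). Qed.

Definition tscale (k : K) (t : tensor) : tensor := cl (k *: repr t).

Lemma tscaleE k x : tscale k (cl x) = cl (k *: x).
Proof.
apply/tensor_eqP; rewrite -scalerBr; apply: tkerZ.
by apply/tensor_eqP; rewrite reprK.
Qed.

Lemma tscaleA k l t : tscale k (tscale l t) = tscale (k * l) t.
Proof. by rewrite -[t]reprK (tscaleE l) !tscaleE scalerA. Qed.

Lemma tscale1 : left_id 1 tscale.
Proof. by move=> t; rewrite -[t]reprK !tscaleE scale1r. Qed.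

Lemma tscaleDr : right_distributive tscale +%R.
Proof.
move=> k s t; rewrite -[t]reprK -[s]reprK -tensor_piD !tscaleE.
by rewrite scalerDr tensor_piD.
Qed.

Lemma tscaleDl t : {morph tscale^~ t : k l / k + l}.
Proof. by move=> k l; rewrite -[t]reprK !tscaleE scalerDl tensor_piD. Qed.

HB.instance Definition _ := GRing.Zmodule_isLmodule.Build K tensor
  tscaleA tscale1 tscaleDr tscaleDl.

Definition tpure (u : U) (v : V) : tensor := cl << (u, v) >>.

End TensorProduct.

Arguments tensor {K} U%_type_scope V%_type_scope.

Notation "U ⊗ V" := (tensor U V)
  (at level 40, left associativity) : type_scope.
Notation "u ⊗ v" := (tpure u v)
  (at level 40, left associativity) : ring_scope.

Definition bilin (K : fieldType) (U V W : lmodType K) (f : U -> V -> W) : Prop :=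
  (forall v, linear (f^~ v)) /\ (forall u, linear (f u)).

(** The linear map [U ⊗ V -> W] induced by a bilinear map [f].  It is defined
    on representatives, hence for every [f], but is only meaningful when [f] is
    bilinear; see [tlift_linear] and [tliftE]. *)
Definition tlift (K : fieldType) (U V W : lmodType K) (f : U -> V -> W)
    (t : U ⊗ V) : W :=
  fglift (fun p : U * V => f p.1 p.2) (repr t).

Definition tmap (K : fieldType) (U V U' V' : lmodType K)
    (f : U -> U') (g : V -> V') : U ⊗ V -> U' ⊗ V' :=
  tlift (fun u v => f u ⊗ g v).

Section TensorTheory.
Variables (K : fieldType) (U V W : lmodType K).

Lemma tpure_bilin : bilin (@tpure K U V).
Proof.
have piZ k (x : {freeg (U * V) / K}) :
  \pi_(U ⊗ V) (k *: x) = k *: (\pi_(U ⊗ V) x : U ⊗ V) by rewrite -tscaleE.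
split=> [v k u u'|u k v v'].
- rewrite /tpure -piZ -tensor_piD; apply/tensor_eqP.
  rewrite -[X in X - _](subrK (<< (k *: u, v) >> + << (u', v) >>)) -addrA.
  apply: tkerD; first by rewrite opprD addrA; exact: tker_Dl.
  by rewrite [X in tker (_ - X)]addrC opprD addrA addrK; exact: tker_Zl.
- rewrite /tpure -piZ -tensor_piD; apply/tensor_eqP.
  rewrite -[X in X - _](subrK (<< (u, k *: v) >> + << (u, v') >>)) -addrA.
  apply: tkerD; first by rewrite opprD addrA; exact: tker_Dr.
  by rewrite [X in tker (_ - X)]addrC opprD addrA addrK; exact: tker_Zr.
Qed.

Lemma tpureDl u u' (v : V) : (u + u' : U) ⊗ v = u ⊗ v + u' ⊗ v.
Proof. by have := tpure_bilin.1 v 1 u u'; rewrite !scale1r. Qed.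

Lemma tpureDr (u : U) (v v' : V) : u ⊗ (v + v') = u ⊗ v + u ⊗ v'.
Proof. by have := tpure_bilin.2 u 1 v v'; rewrite !scale1r. Qed.

Lemma tpure0l (v : V) : (0 : U) ⊗ v = 0.
Proof. by apply: (addIr (0 ⊗ v)); rewrite -tpureDl !add0r. Qed.

Lemma tpure0r (u : U) : u ⊗ (0 : V) = 0.
Proof. by apply: (addIr (u ⊗ 0)); rewrite -tpureDr !add0r. Qed.

Lemma tpureZl k (u : U) (v : V) : (k *: u) ⊗ v = k *: (u ⊗ v).
Proof. by have := tpure_bilin.1 v k u 0; rewrite tpure0l !addr0. Qed.

Lemma tpureZr k (u : U) (v : V) : u ⊗ (k *: v) = k *: (u ⊗ v).
Proof. by have := tpure_bilin.2 u k v 0; rewrite tpure0r !addr0. Qed.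

Lemma fglift_linear (T : choiceType) (f : T -> W) : linear (@fglift K W T f).
Proof.
move=> k x y.
have FB := lift_is_additive f.
have F0 : fglift f 0 = 0 by have := FB 0 0; rewrite !subrr.
have FN z : fglift f (- z) = - fglift f z by rewrite -sub0r FB F0 sub0r.
have FD a b : fglift f (a + b) = fglift f a + fglift f b.
  by rewrite -{1}(opprK b) FB FN opprK.
have FS (I : Type) (s : seq I) (g : I -> {freeg T / K}) :
    fglift f (\sum_(i <- s) g i) = \sum_(i <- s) fglift f (g i).
  by elim: s => [|i s IH]; rewrite ?big_nil // !big_cons FD IH.
rewrite FD -{1}(freeg_sumE x) -[in RHS](freeg_sumE x); congr (_ + _).
rewrite scaler_sumr !FS scaler_sumr; apply: eq_bigr => z _.
have -> : k *: << coeff z x *g z >> = << k * coeff z x *g z >> :> {freeg T / K}.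
  by apply/eqP/freeg_eqP => z'; rewrite coeffZ !coeffU mulrA.
by rewrite !liftU scalerA.
Qed.

Variable f : U -> V -> W.
Hypothesis f_bilin : bilin f.

Lemma fglift_tker x : tker x -> fglift (fun p : U * V => f p.1 p.2) x = 0.
Proof.
set F := fglift _; have FL : linear F := fglift_linear _.
have FD a b : F (a + b) = F a + F b by rewrite -{1}(scale1r a) FL scale1r.
have F0 : F 0 = 0 by apply: (addIr (F 0)); rewrite -FD !add0r.
have FZ k a : F (k *: a) = k *: F a by rewrite -[k *: a]addr0 FL F0 addr0.
have FN a : F (- a) = - F a by rewrite -(scaleN1r a) FZ scaleN1r.
have FU u v : F << (u, v) >> = f u v by rewrite /F liftU scale1r.
have [fl fr] := f_bilin.
have f0l v : f 0 v = 0.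
  by apply: (addIr (f 0 v)); have := fl v 1 0 0; rewrite !scale1r !add0r.
have f0r u : f u 0 = 0.
  by apply: (addIr (f u 0)); have := fr u 1 0 0; rewrite !scale1r !add0r.
elim=> {x} [//|x y _ xi _ yi|k x _ xi|u u' v|u v v'|k u v|k u v].
- by rewrite FD xi yi addr0.
- by rewrite FZ xi scaler0.
- by rewrite !FD !FN !FU; have := fl v 1 u u'; rewrite !scale1r => ->; rewrite addrAC addrK subrr.
- by rewrite !FD !FN !FU; have := fr u 1 v v'; rewrite !scale1r => ->; rewrite addrAC addrK subrr.
- by rewrite FD FN FZ !FU; have := fl v k u 0; rewrite f0l !addr0 => ->; rewrite subrr.
- by rewrite FD FN FZ !FU; have := fr u k v 0; rewrite f0r !addr0 => ->; rewrite subrr.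
Qed.

Lemma tlift_pi x :
  tlift f (\pi_(U ⊗ V) x : U ⊗ V) = fglift (fun p : U * V => f p.1 p.2) x.
Proof.
rewrite /tlift; apply/eqP; rewrite -subr_eq0 -lift_is_additive; apply/eqP.
by apply/fglift_tker/tensor_eqP; rewrite reprK.
Qed.

Lemma tlift_linear : linear (tlift f).
Proof.
move=> k s t; rewrite -{1}[s]reprK -{1}[t]reprK.
by rewrite [k *: _]tscaleE -tensor_piD tlift_pi fglift_linear.
Qed.

Lemma tliftE u v : tlift f (u ⊗ v) = f u v.
Proof. by rewrite /tpure tlift_pi liftU scale1r. Qed.

End TensorTheory.

Section TensorInduction.
Variables (K : fieldType) (U V : lmodType K).

Lemma tensor_ind (P : U ⊗ V -> Prop) :
    (forall u v, P (u ⊗ v)) -> (forall s t, P s -> P t -> P (s + t)) ->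
  forall t, P t.
Proof.
move=> Ppure PD t; rewrite -[t]reprK -(freeg_sumE (repr t)).
elim: (dom _) => [|z s IH].
  rewrite big_nil; suff -> : \pi_(U ⊗ V) 0 = (0 : U) ⊗ (0 : V) by [].
  rewrite tpure0l; apply: (addIr (\pi_(U ⊗ V) 0 : U ⊗ V)).
  by rewrite -tensor_piD !add0r.
rewrite big_cons tensor_piD; apply: PD => //.
suff -> : \pi_(U ⊗ V) << coeff z (repr t) *g z >> =
          (coeff z (repr t) *: z.1) ⊗ z.2 by [].
rewrite tpureZl /tpure [RHS]tscaleE; congr (\pi_(U ⊗ V) _).
by apply/eqP/freeg_eqP => z'; rewrite coeffZ !coeffU mul1r; case: z.
Qed.

Lemma linD (W : lmodType K) (F : U -> W) : linear F -> {morph F : x y / x + y}.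
Proof. by move=> FL x y; rewrite -{1}(scale1r x) FL scale1r. Qed.

Lemma linZ (W : lmodType K) (F : U -> W) k : linear F -> {morph F : x / k *: x}.
Proof.
move=> FL x; have F0 : F 0 = 0.
  by apply: (addIr (F 0)); rewrite -linD // !add0r.
by rewrite -[k *: x]addr0 FL F0 addr0.
Qed.

Lemma eq_tensor (W : lmodType K) (F G : U ⊗ V -> W) :
    linear F -> linear G -> (forall u v, F (u ⊗ v) = G (u ⊗ v)) -> F =1 G.
Proof.
have D (H : U ⊗ V -> W) : linear H -> {morph H : s t / s + t}.
  by move=> HL s t; rewrite -{1}(scale1r s) HL scale1r.
move=> FL GL FG; elim/tensor_ind => // s t es et.
by rewrite !D // es et.
Qed.

End TensorInduction.

Section TensorMap.
Variables (K : fieldType) (U V U' V' : lmodType K) (f : U -> U') (g : V -> V').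
Hypotheses (fL : linear f) (gL : linear g).

Lemma tmap_bilin : bilin (fun u v => f u ⊗ g v).
Proof.
split=> [v k u u'|u k v v']; first by rewrite fL tpureDl tpureZl.
by rewrite gL tpureDr tpureZr.
Qed.

Lemma tmap_linear : linear (tmap f g).
Proof. exact/tlift_linear/tmap_bilin. Qed.

Lemma tmapE u v : tmap f g (u ⊗ v) = f u ⊗ g v.
Proof. exact/tliftE/tmap_bilin. Qed.

End TensorMap.

(** * Associative algebras, possibly without unit

    The product is the semigroup law [( _ * _)%g] of the library. *)

HB.mixin Record isBilinearSemigroup (K : fieldType) A
    of GRing.Lmodule K A & Semigroup A := {
  nmulDl : forall a b c : A, ((a + b)%R * c = (a * c)%g + (b * c)%g)%g;
  nmulDr : forall a b c : A, (a * (b + c)%R = (a * b)%g + (a * c)%g)%g;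
  nmulZl : forall (k : K) (a b : A), ((k *: a)%R * b = k *: (a * b)%g)%g;
  nmulZr : forall (k : K) (a b : A), (a * (k *: b)%R = k *: (a * b)%g)%g
}.

#[short(type="nualgType")]
HB.structure Definition NUAlgebra (K : fieldType) :=
  { A of GRing.Lmodule K A & Semigroup A & isBilinearSemigroup K A }.

HB.mixin Record isNondegenerate (K : fieldType) A of NUAlgebra K A := {
  nondegl : forall b : A, (forall a : A, (a * b)%g = 0) -> b = 0;
  nondegr : forall a : A, (forall b : A, (a * b)%g = 0) -> a = 0
}.

#[short(type="ndalgType")]
HB.structure Definition NDAlgebra (K : fieldType) :=
  { A of NUAlgebra K A & isNondegenerate K A }.

Section MulLinear.
Variables (K : fieldType) (A : nualgType K).

Lemma nmull_linear (a : A) : linear (fun b : A => (a * b)%g).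
Proof. by move=> k b c; rewrite nmulDr nmulZr. Qed.

Lemma nmulr_linear (b : A) : linear (fun a : A => (a * b)%g).
Proof. by move=> k a c; rewrite nmulDl nmulZl. Qed.

Definition mulmap : A ⊗ A -> A := tlift (fun a b => (a * b)%g).

End MulLinear.

Section TensorAlgebra.
Variables (K : fieldType) (A B : nualgType K).

Definition tmul (s t : A ⊗ B) : A ⊗ B :=
  tlift (fun a b => tmap (fun x : A => (a * x)%g) (fun y : B => (b * y)%g) t) s.

Let Fa a b := tmap (fun x : A => (a * x)%g) (fun y : B => (b * y)%g).

Let FaL a b : linear (Fa a b).
Proof. by apply: tmap_linear; exact: nmull_linear. Qed.

Let FaE a b u v : Fa a b (u ⊗ v) = (a * u)%g ⊗ (b * v)%g.
Proof. by rewrite /Fa tmapE //; exact: nmull_linear. Qed.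

Let tmul_bilin t : bilin (fun a b => Fa a b t).
Proof.
split=> [b k a a'|a k b b']; elim/tensor_ind: t => [x y|s t es et].
- by rewrite !FaE nmulDl nmulZl tpureDl tpureZl.
- by rewrite !(linD (@FaL _ _)) es et scalerDr addrACA.
- by rewrite !FaE nmulDl nmulZl tpureDr tpureZr.
- by rewrite !(linD (@FaL _ _)) es et scalerDr addrACA.
Qed.

Lemma tmulE a b a' b' : tmul (a ⊗ b) (a' ⊗ b') = (a * a')%g ⊗ (b * b')%g.
Proof. by rewrite /tmul (tliftE (@tmul_bilin _)) FaE. Qed.

Lemma tmull_linear t : linear (tmul^~ t).
Proof. exact: tlift_linear (tmul_bilin t). Qed.

Lemma tmulr_linear s : linear (tmul s).
Proof.
elim/tensor_ind: s => [a b|s s' es es'] k t t'.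
  by rewrite /tmul !(tliftE (@tmul_bilin _)) [LHS]FaL.
by rewrite !(linD (@tmull_linear _)) es es' scalerDr addrACA.
Qed.

Lemma tmulA : associative tmul.
Proof.
move=> s t r; elim/tensor_ind: s => [a b|s s' es es']; last first.
  by rewrite !(linD (@tmull_linear _)) es es'.
elim/tensor_ind: t => [a' b'|t t' et et']; last first.
  by rewrite (linD (@tmulr_linear _)) !(linD (@tmull_linear _))
     !(linD (@tmulr_linear _)) et et'.
elim/tensor_ind: r => [a'' b''|r r' er er']; last first.
  by rewrite !(linD (@tmulr_linear _)) er er'.
by rewrite !tmulE !mulgA.
Qed.

HB.instance Definition _ := isSemigroup.Build (A ⊗ B)%type tmulA.

Lemma tmulDl (s t r : A ⊗ B) : (((s + t)%R * r)%g = (s * r)%g + (t * r)%g).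
Proof. exact: (linD (@tmull_linear r)). Qed.
Lemma tmulDr (s t r : A ⊗ B) : ((s * (t + r)%R)%g = (s * t)%g + (s * r)%g).
Proof. exact: (linD (@tmulr_linear s)). Qed.
Lemma tmulZl k (s t : A ⊗ B) : (((k *: s)%R * t)%g = k *: (s * t)%g).
Proof. exact: (linZ k (@tmull_linear t)). Qed.
Lemma tmulZr k (s t : A ⊗ B) : ((s * (k *: t)%R)%g = k *: (s * t)%g).
Proof. exact: (linZ k (@tmulr_linear s)). Qed.

HB.instance Definition _ :=
  isBilinearSemigroup.Build K (A ⊗ B)%type tmulDl tmulDr tmulZl tmulZr.

Lemma tmul_pure (a a' : A) (b b' : B) :
  ((a ⊗ b) * (a' ⊗ b'))%g = (a * a')%g ⊗ (b * b')%g.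
Proof. exact: tmulE. Qed.

End TensorAlgebra.

(** * Nondegeneracy of the tensor product *)

Section Separation.
Variables (K : fieldType) (V : lmodType K).

Definition subspace (P : V -> Prop) :=
  P 0 /\ forall k x y, P x -> P y -> P (k *: x + y).

Lemma separating_functional (P : V -> Prop) (v : V) : subspace P -> ~ P v ->
  exists phi : V -> K, [/\ scalar phi, forall x, P x -> phi x = 0 & phi v = 1].
Proof.
move=> [P0 PL] Pv.
pose good (Q : set V) := [/\ forall k x y, Q x -> Q y -> Q (k *: x + y), ~ Q v &
  forall x, Q x -> P `<=` Q]%classic.
have [F Fgood Ftot|M [[ML Mv MP] Mmax]] := @Zorn_bigcup V good.
  split=> [k x y [X FX Xx] [Y FY Yy]|[X FX Xv]|x [X FX Xx] y Py].
  - have [XY|YX] := Ftot _ _ FX FY; [exists Y|exists X] => //.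
      by have [YL _ _] := Fgood _ FY; apply: YL => //; exact: XY.
    by have [XL _ _] := Fgood _ FX; apply: XL => //; exact: YX.
  - by have [_ + _] := Fgood _ FX; exact.
  - by exists X => //; have [_ _ /(_ _ Xx)] := Fgood _ FX; exact.
have M0 : M 0.
  have Pgood : good P by split=> // x _ y.
  apply: contrapT => nM0; apply: (Mmax P) => //; split; last first.
    by move=> PM; exact/nM0/PM.
  by move=> x Mx; case: nM0; exact: (MP x).
have {}MP : (P `<=` M)%classic by exact: MP M0.
have MZ k x : M x -> M (k *: x) by move=> Mx; rewrite -[_ *: _]addr0; exact: ML.
have MD x y : M x -> M y -> M (x + y) by move=> Mx My; rewrite -(scale1r x); exact: ML.
have MN x : M x -> M (- x) by rewrite -scaleN1r; exact: MZ.
have dec u : exists c, M (u - c *: v).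
  have [Mu|nMu] := pselect (M u); first by exists 0; rewrite scale0r subr0.
  pose M' : set V := [set x | exists k m, M m /\ x = k *: u + m]%classic.
  have MM' : (M `<=` M')%classic.
    by move=> m Mm; exists 0, m; split=> //; rewrite scale0r add0r.
  have [M'v|nM'v] := pselect (M' v); last first.
    case: (Mmax M').
      split=> //; last by move=> M'M; apply: nMu; apply: M'M; exists 1, 0; rewrite scale1r addr0.
    split=> // [k x y [k1 [m1 [h1 ->]]] [k2 [m2 [h2 ->]]]|x _ y /MP /MM' //].
    exists (k * k1 + k2), (k *: m1 + m2); split; first exact: ML.
    by rewrite scalerDl scalerDr scalerA addrACA.
  have [k [m [Mm vE]]] := M'v.
  have k0 : k != 0 by apply: contra_notN Mv => /eqP k0; rewrite vE k0 scale0r add0r.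
  exists k^-1; rewrite vE scalerDr scalerA mulVf // scale1r opprD addrA subrr add0r.
  by rewrite -scalerN; apply/MZ/MN.
have uniq u c d : M (u - c *: v) -> M (u - d *: v) -> c = d.
  move=> Mc Md; apply: contrapT => /eqP cd; apply: Mv.
  have -> : v = (d - c)^-1 *: ((u - c *: v) - (u - d *: v)).
    rewrite opprB [X in _ *: X]addrC addrA subrK -scalerBl scalerA mulVf ?scale1r //.
    by rewrite subr_eq0 eq_sym.
  by apply/MZ/MD => //; exact: MN.
have [phi phiP] := choice dec.
exists phi; split.
- move=> k x y; apply: (uniq (k *: x + y)) => //.
  rewrite scalerDl opprD addrACA -scalerA -scalerBr.
  exact: ML.
- by move=> x Px; apply: (uniq x) => //; rewrite scale0r subr0; exact: MP.
- by apply: (uniq v) => //; rewrite scale1r subrr.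
Qed.

End Separation.

Section Slices.
Variables (K : fieldType) (U V : lmodType K).

Definition slicer (phi : V -> K) : U ⊗ V -> U := tlift (fun u v => phi v *: u).
Definition slicel (psi : U -> K) : U ⊗ V -> V := tlift (fun u v => psi u *: v).

Lemma slicer_bilin (phi : V -> K) : scalar phi -> bilin (fun (u : U) v => phi v *: u).
Proof.
move=> phiL; split=> [v k u u'|u k v v'].
  by rewrite scalerDr !scalerA mulrC.
by rewrite phiL scalerDl scalerA.
Qed.

Lemma slicel_bilin (psi : U -> K) : scalar psi -> bilin (fun u (v : V) => psi u *: v).
Proof.
move=> psiL; split=> [v k u u'|u k v v']; first by rewrite psiL scalerDl scalerA.
by rewrite scalerDr !scalerA mulrC.
Qed.

Lemma tensor_sum (t : U ⊗ V) :
  exists s : seq (U * V), t = \sum_(p <- s) p.1 ⊗ p.2.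
Proof.
elim/tensor_ind: t => [u v|_ _ [s ->] [r ->]].
  by exists [:: (u, v)]; rewrite big_seq1.
by exists (s ++ r); rewrite big_cat.
Qed.

Fixpoint spanned (s : seq V) (w : V) : Prop :=
  if s is v :: s' then exists k, spanned s' (w - k *: v) else w = 0.

Lemma spanned_subspace s : subspace (spanned s).
Proof.
elim: s => [|v s [IH0 IHL]]; first by split=> // k x y -> ->; rewrite scaler0 addr0.
split; first by exists 0; rewrite scale0r subr0.
move=> k x y [c xc] [d yd]; exists (k * c + d).
by rewrite scalerDl opprD addrACA -scalerA -scalerBr; exact: IHL.
Qed.

Lemma spanned_mem s v : v \in s -> spanned s v.
Proof.
elim: s => // w s IH; rewrite inE => /predU1P[->|vs].
  by exists 1; rewrite scale1r subrr; exact: (spanned_subspace s).1.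
by exists 0; rewrite scale0r subr0; exact: IH.
Qed.

Lemma slicer_eq0 (t : U ⊗ V) :
  (forall phi : V -> K, scalar phi -> slicer phi t = 0) -> t = 0.
Proof.
have [s -> {t}] := tensor_sum t.
have sliceE (phi : V -> K) r : scalar phi ->
    slicer phi (\sum_(p <- r) p.1 ⊗ p.2) = \sum_(p <- r) phi p.2 *: p.1.
  move=> phiL; have SB := slicer_bilin phiL.
  have SL : linear (slicer phi) := tlift_linear SB.
  elim: r => [|p r IH].
    rewrite !big_nil; apply: (addIr (slicer phi 0)).
    by rewrite -(linD SL) !add0r.
  by rewrite !big_cons (linD SL) IH /slicer (tliftE SB).
elim: {s}(size s) {-2}s (leqnn (size s)) => [|n IH] s.
  by rewrite leqn0 size_eq0 => /eqP->; rewrite big_nil.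
case: s => [|[u v] s] /=; first by rewrite big_nil.
rewrite ltnS => sn h; rewrite big_cons.
have [vs|vs] := pselect (spanned (map snd s) v).
  suff [r rs re] : exists2 r : seq (U * V), size r = size s &
      u ⊗ v + \sum_(p <- s) p.1 ⊗ p.2 = \sum_(p <- r) p.1 ⊗ p.2.
    by rewrite /= re; apply: IH; rewrite ?rs // => phi /h; rewrite big_cons re.
  clear -vs; elim: s v vs => [v /= ->|[u' v'] s IH v [k /IH[r rs re]]].
    by exists [::] => //; rewrite tpure0r !big_nil addr0.
  exists ((u' + k *: u, v') :: r) => /=; first by rewrite rs.
  rewrite !big_cons -re /= -{1}(subrK (k *: v') v); set w := v - _.
  rewrite tpureDr tpureDl tpureZr tpureZl.
  by rewrite [X in X + _]addrC addrACA [X in X + _]addrC.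
have [phi [phiL phis phiv]] := separating_functional (spanned_subspace _) vs.
have u0 : u = 0.
  have := h _ phiL; rewrite sliceE // big_cons /= phiv scale1r big_seq big1 ?addr0 //.
  by move=> p ps; rewrite phis ?scale0r //; exact/spanned_mem/map_f.
rewrite /= u0 tpure0l add0r; apply: IH => // psi /h.
by rewrite big_cons /= u0 tpure0l add0r.
Qed.

End Slices.

Section Swap.
Variables (K : fieldType) (U V : lmodType K).

Definition tswap : U ⊗ V -> V ⊗ U := tlift (fun u v => v ⊗ u).

Lemma tswap_bilin : bilin (fun (u : U) (v : V) => v ⊗ u).
Proof. by split=> [v|u] k x y; rewrite ?tpureDr ?tpureZr ?tpureDl ?tpureZl. Qed.

End Swap.

Lemma tswapK (K : fieldType) (U V : lmodType K) :
  cancel (@tswap K U V) (@tswap K V U).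
Proof.
apply: eq_tensor => [k s t|//|u v].
  by rewrite /tswap !(tlift_linear (tswap_bilin _ _)).
by rewrite /tswap !(tliftE (tswap_bilin _ _)).
Qed.

Lemma slicel_eq0 (K : fieldType) (U V : lmodType K) (t : U ⊗ V) :
  (forall psi : U -> K, scalar psi -> slicel psi t = 0) -> t = 0.
Proof.
move=> h; rewrite -[t]tswapK.
suff -> : tswap t = 0.
  apply: (addIr (tswap 0)); rewrite -(linD (tlift_linear (tswap_bilin _ _))).
  by rewrite !add0r.
apply: slicer_eq0 => phi phiL; rewrite -[RHS](h phi phiL).
move: t {h}; apply: eq_tensor => [k s t||u v].
- by rewrite /slicer /tswap !(tlift_linear (tswap_bilin _ _), tlift_linear (slicer_bilin _ phiL)).
- exact: tlift_linear (slicel_bilin _ phiL).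
- by rewrite /slicer /slicel /tswap (tliftE (tswap_bilin _ _)) (tliftE (slicer_bilin _ phiL))
    (tliftE (slicel_bilin _ phiL)).
Qed.

Lemma slicer_linear (K : fieldType) (U V : lmodType K) (phi : V -> K) :
  scalar phi -> linear (@slicer K U V phi).
Proof. by move=> phiL; exact: tlift_linear (slicer_bilin U phiL). Qed.

Lemma slicel_linear (K : fieldType) (U V : lmodType K) (psi : U -> K) :
  scalar psi -> linear (@slicel K U V psi).
Proof. by move=> psiL; exact: tlift_linear (slicel_bilin V psiL). Qed.

Lemma slicerE (K : fieldType) (U V : lmodType K) (phi : V -> K) u v :
  scalar phi -> @slicer K U V phi (u ⊗ v) = phi v *: u.
Proof. by move=> phiL; exact: tliftE (slicer_bilin U phiL) _ _. Qed.

Lemma slicelE (K : fieldType) (U V : lmodType K) (psi : U -> K) u v :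
  scalar psi -> @slicel K U V psi (u ⊗ v) = psi u *: v.
Proof. by move=> psiL; exact: tliftE (slicel_bilin V psiL) _ _. Qed.

Lemma lin0 (K : fieldType) (U W : lmodType K) (F : U -> W) : linear F -> F 0 = 0.
Proof. by move=> FL; apply: (addIr (F 0)); rewrite -linD // !add0r. Qed.

Section TensorNondegenerate.
Variables (K : fieldType) (A B : ndalgType K).

Lemma tensor_nondegl (t : A ⊗ B) :
  (forall s : A ⊗ B, (s * t)%g = 0) -> t = 0.
Proof.
move=> h.
pose ty y := tmap id (fun b : B => (y * b)%g) t.
have idL (W : lmodType K) : linear (@id W) by [].
have TL y : linear (tmap id (fun b : B => (y * b)%g) : A ⊗ B -> A ⊗ B).
  exact: tmap_linear (idL _) (nmull_linear y).
have ty0 y : ty y = 0.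
  apply: slicer_eq0 => phi phiL; apply: nondegl => x.
  have SD := linD (slicer_linear (U := A) phiL).
  transitivity (slicer phi ((x ⊗ y) * t)%g); last by rewrite h (lin0 (slicer_linear phiL)).
  rewrite /ty; elim/tensor_ind: {h ty} t => [a b|s s' es es'].
    by rewrite (tmapE (idL _) (nmull_linear y)) tmul_pure !slicerE // nmulZr.
  by rewrite (linD (TL y)) nmulDr !SD nmulDr es es'.
apply: slicel_eq0 => psi psiL; apply: nondegl => y.
have SD := linD (slicel_linear (V := B) psiL).
transitivity (slicel psi (ty y)); last by rewrite ty0 (lin0 (slicel_linear psiL)).
rewrite /ty; elim/tensor_ind: {h ty ty0} t => [a b|s s' es es'].
  by rewrite (tmapE (idL _) (nmull_linear y)) !slicelE // nmulZr.
by rewrite (linD (TL y)) !SD nmulDr es es'.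
Qed.

Lemma tensor_nondegr (t : A ⊗ B) :
  (forall s : A ⊗ B, (t * s)%g = 0) -> t = 0.
Proof.
move=> h.
pose ty y := tmap id (fun b : B => (b * y)%g) t.
have idL (W : lmodType K) : linear (@id W) by [].
have TL y : linear (tmap id (fun b : B => (b * y)%g) : A ⊗ B -> A ⊗ B).
  exact: tmap_linear (idL _) (nmulr_linear y).
have ty0 y : ty y = 0.
  apply: slicer_eq0 => phi phiL; apply: nondegr => x.
  have SD := linD (slicer_linear (U := A) phiL).
  transitivity (slicer phi (t * (x ⊗ y))%g); last by rewrite h (lin0 (slicer_linear phiL)).
  rewrite /ty; elim/tensor_ind: {h ty} t => [a b|s s' es es'].
    by rewrite (tmapE (idL _) (nmulr_linear y)) tmul_pure !slicerE // nmulZl.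
  by rewrite (linD (TL y)) nmulDl !SD nmulDl es es'.
apply: slicel_eq0 => psi psiL; apply: nondegr => y.
have SD := linD (slicel_linear (V := B) psiL).
transitivity (slicel psi (ty y)); last by rewrite ty0 (lin0 (slicel_linear psiL)).
rewrite /ty; elim/tensor_ind: {h ty ty0} t => [a b|s s' es es'].
  by rewrite (tmapE (idL _) (nmulr_linear y)) !slicelE // nmulZl.
by rewrite (linD (TL y)) !SD nmulDl es es'.
Qed.

HB.instance Definition _ :=
  isNondegenerate.Build K (A ⊗ B)%type tensor_nondegl tensor_nondegr.

End TensorNondegenerate.

(** * Multiplier algebra

    For a multiplier [x = (L, R)] of [A] and [a : A], [mactl x a] is
    [xa = L(a)] and [mactr a x] is [ax = R(a)]; the product of multipliers is
    the one for which [(xy)a = x(ya)] and [a(xy) = (ax)y]. *)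

Section Multiplier.
Variables (K : fieldType) (A : nualgType K).

Definition is_mult (x : (A -> A) * (A -> A)) : Prop :=
  [/\ linear x.1, linear x.2,
      forall a b, x.1 (a * b)%g = (x.1 a * b)%g,
      forall a b, x.2 (a * b)%g = (a * x.2 b)%g
    & forall a b, (x.2 a * b)%g = (a * x.1 b)%g].

Definition is_multb : {pred (A -> A) * (A -> A)} := fun x => `[< is_mult x >].

Lemma nmul0l (a : A) : ((0 : A) * a)%g = 0.
Proof. by have := nmulZl 0 0 a; rewrite !scale0r. Qed.

Lemma nmul0r (a : A) : (a * (0 : A))%g = 0.
Proof. by have := nmulZr 0 a 0; rewrite !scale0r. Qed.

Lemma is_multb_submod_closed : submod_closed is_multb.
Proof.
split=> [|k x y /asboolP[xL xR xl xr xc] /asboolP[yL yR yl yr yc]]; apply/asboolP.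
  have E1 a : (0 : (A -> A) * (A -> A)).1 a = 0 by [].
  have E2 a : (0 : (A -> A) * (A -> A)).2 a = 0 by [].
  by split=> [k a b|k a b|a b|a b|a b]; rewrite ?E1 ?E2 ?scaler0 ?addr0 ?nmul0l ?nmul0r.
have E1 a : (k *: x + y).1 a = k *: x.1 a + y.1 a by [].
have E2 a : (k *: x + y).2 a = k *: x.2 a + y.2 a by [].
split=> [l a b|l a b|a b|a b|a b]; rewrite ?E1 ?E2.
- by rewrite xL yL !scalerDr !scalerA mulrC addrACA.
- by rewrite xR yR !scalerDr !scalerA mulrC addrACA.
- by rewrite xl yl nmulDl nmulZl.
- by rewrite xr yr nmulDr nmulZr.
- by rewrite nmulDl nmulZl nmulDr nmulZr xc yc.
Qed.

HB.instance Definition _ := GRing.isSubmodClosed.Build K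
  ((A -> A) * (A -> A))%type is_multb is_multb_submod_closed.

Record mult : Type := Mult {
  mult_val :> (A -> A) * (A -> A);
  mult_valP : mult_val \in is_multb }.

HB.instance Definition _ := [isSub for mult_val].
HB.instance Definition _ := [Choice of mult by <:].
HB.instance Definition _ := [SubChoice_isSubLmodule of mult by <:].

Definition mactl (x : mult) (a : A) : A := x.1 a.
Definition mactr (a : A) (x : mult) : A := x.2 a.

Lemma multP (x : mult) : is_mult x.
Proof. exact/asboolP/mult_valP. Qed.

Definition mkmult x (xP : is_mult x) : mult :=
  Mult (introT (asboolP (is_mult x)) xP).

Lemma mult_eq (x y : mult) : mactl x =1 mactl y -> mactr^~ x =1 mactr^~ y -> x = y.
Proof.
case: x y => [[L R] xP] [[L' R'] yP] eL eR; apply: val_inj => /=.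
have -> : L = L' by apply/funext=> a; exact: eL.
by have -> : R = R' by apply/funext=> a; exact: eR.
Qed.

Lemma mult1_subproof : is_mult (id, id). Proof. by []. Qed.
Definition mult1 : mult := mkmult mult1_subproof.

Lemma multM_subproof (x y : mult) : is_mult (x.1 \o y.1, y.2 \o x.2).
Proof.
have [xL xR xl xr xc] := multP x; have [yL yR yl yr yc] := multP y.
by split=> [k a b|k a b|a b|a b|a b] /=;
  rewrite ?yL ?xL ?xR ?yR ?yl ?xl ?xr ?yr ?yc ?xc.
Qed.
Definition multM (x y : mult) : mult := mkmult (multM_subproof x y).

Lemma multMA : associative multM.
Proof. by move=> x y z; apply: mult_eq. Qed.

HB.instance Definition _ := isSemigroup.Build mult multMA.

Lemma multMDl (x y z : mult) : ((x + y)%R * z = (x * z)%g + (y * z)%g)%g.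
Proof.
by apply: mult_eq => a //; rewrite /mactr /=; have [_ zR _ _ _] := multP z;
  rewrite (linD zR).
Qed.
Lemma multMDr (x y z : mult) : (x * (y + z)%R = (x * y)%g + (x * z)%g)%g.
Proof.
by apply: mult_eq => a //; rewrite /mactl /=; have [xL _ _ _ _] := multP x;
  rewrite (linD xL).
Qed.
Lemma multMZl k (x y : mult) : ((k *: x)%R * y = k *: (x * y)%g)%g.
Proof.
by apply: mult_eq => a //; rewrite /mactr /=; have [_ yR _ _ _] := multP y;
  rewrite (linZ _ yR).
Qed.
Lemma multMZr k (x y : mult) : (x * (k *: y)%R = k *: (x * y)%g)%g.
Proof.
by apply: mult_eq => a //; rewrite /mactl /=; have [xL _ _ _ _] := multP x;
  rewrite (linZ _ xL).
Qed.

HB.instance Definition _ :=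
  isBilinearSemigroup.Build K mult multMDl multMDr multMZl multMZr.

Lemma memb_subproof (a : A) :
  is_mult (fun b : A => (a * b)%g, fun b : A => (b * a)%g).
Proof.
split=> [||b c|b c|b c] /=; rewrite ?mulgA //;
  [exact: nmull_linear|exact: nmulr_linear].
Qed.

(** The canonical homomorphism [A -> M(A)]; see [memb_inj]. *)
Definition memb (a : A) : mult := mkmult (memb_subproof a).

(** The element of [A] whose image in [M(A)] is [x], when there is one (and [0]
    otherwise); it is unique when [A] is nondegenerate, see [membK]. *)
Definition munemb (x : mult) : A := xget 0 [set a | memb a = x]%classic.

End Multiplier.

Arguments mult {K} A%_type_scope.

Section MultiplierTensor.
Variables (K : fieldType) (A B : nualgType K).

Lemma mtens_subproof (x : mult A) (y : mult B) :
  is_mult (tmap x.1 y.1, tmap x.2 y.2).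
Proof.
have [xL xR xl xr xc] := multP x; have [yL yR yl yr yc] := multP y.
have TL := tmap_linear xL yL; have TR := tmap_linear xR yR.
split=> //= s t.
- elim/tensor_ind: s => [a b|s s' es es']; last by rewrite nmulDl !(linD TL) nmulDl es es'.
  elim/tensor_ind: t => [a' b'|t t' et et']; last by rewrite nmulDr !(linD TL) nmulDr et et'.
  by rewrite tmul_pure !tmapE // tmul_pure xl yl.
- elim/tensor_ind: s => [a b|s s' es es']; last by rewrite nmulDl !(linD TR) nmulDl es es'.
  elim/tensor_ind: t => [a' b'|t t' et et']; last by rewrite nmulDr !(linD TR) nmulDr et et'.
  by rewrite tmul_pure !tmapE // tmul_pure xr yr.
- elim/tensor_ind: s => [a b|s s' es es']; last by rewrite (linD TR) !nmulDl es es'.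
  elim/tensor_ind: t => [a' b'|t t' et et']; last by rewrite (linD TL) !nmulDr et et'.
  by rewrite !tmapE // !tmul_pure xc yc.
Qed.

(** [x ⊗ y] as a multiplier of [A ⊗ B]: the embedding of [M(A) ⊗ M(B)] into
    [M(A ⊗ B)] on pure tensors. *)
Definition mtens (x : mult A) (y : mult B) : mult (A ⊗ B) :=
  mkmult (mtens_subproof x y).

Lemma mtens_bilin : bilin mtens.
Proof.
split=> [y k x x'|x k y y']; apply: mult_eq; elim/tensor_ind => [a b|s t es et].
- have [[xL _ _ _ _] [x'L _ _ _ _] [yL _ _ _ _] [zL _ _ _ _]] :=
    And4 (multP x) (multP x') (multP y) (multP (k *: x + x')).
  have E : mactl (k *: mtens x y + mtens x' y) (a ⊗ b) =
    k *: tmap x.1 y.1 (a ⊗ b) + tmap x'.1 y.1 (a ⊗ b) by [].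
  by rewrite E [LHS](tmapE zL yL) !tmapE // -tpureZl -tpureDl.
- have D (z : mult (A ⊗ B)) : {morph mactl z : s t / s + t}.
    by apply: linD; have [] := multP z.
  by rewrite !D es et.
- have [[_ xL _ _ _] [_ x'L _ _ _] [_ yL _ _ _] [_ zL _ _ _]] :=
    And4 (multP x) (multP x') (multP y) (multP (k *: x + x')).
  have E : mactr (a ⊗ b) (k *: mtens x y + mtens x' y) =
    k *: tmap x.2 y.2 (a ⊗ b) + tmap x'.2 y.2 (a ⊗ b) by [].
  by rewrite E [LHS](tmapE zL yL) !tmapE // -tpureZl -tpureDl.
- have D (z : mult (A ⊗ B)) : {morph (@mactr K _)^~ z : s t / s + t}.
    by apply: linD; have [] := multP z.
  by rewrite !D es et.
- have [[xL _ _ _ _] [yL _ _ _ _] [y'L _ _ _ _] [zL _ _ _ _]] :=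
    And4 (multP x) (multP y) (multP y') (multP (k *: y + y')).
  have E : mactl (k *: mtens x y + mtens x y') (a ⊗ b) =
    k *: tmap x.1 y.1 (a ⊗ b) + tmap x.1 y'.1 (a ⊗ b) by [].
  by rewrite E [LHS](tmapE xL zL) !tmapE // -tpureZr -tpureDr.
- have D (z : mult (A ⊗ B)) : {morph mactl z : s t / s + t}.
    by apply: linD; have [] := multP z.
  by rewrite !D es et.
- have [[_ xL _ _ _] [_ yL _ _ _] [_ y'L _ _ _] [_ zL _ _ _]] :=
    And4 (multP x) (multP y) (multP y') (multP (k *: y + y')).
  have E : mactr (a ⊗ b) (k *: mtens x y + mtens x y') =
    k *: tmap x.2 y.2 (a ⊗ b) + tmap x.2 y'.2 (a ⊗ b) by [].
  by rewrite E [LHS](tmapE xL zL) !tmapE // -tpureZr -tpureDr.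
- have D (z : mult (A ⊗ B)) : {morph (@mactr K _)^~ z : s t / s + t}.
    by apply: linD; have [] := multP z.
  by rewrite !D es et.
Qed.

End MultiplierTensor.

Lemma memb_linear (K : fieldType) (A : nualgType K) : linear (@memb K A).
Proof.
move=> k a b; apply: mult_eq => c; first by rewrite /mactl /= nmulDl nmulZl.
by rewrite /mactr /= nmulDr nmulZr.
Qed.

Lemma memb_inj (K : fieldType) (A : ndalgType K) : injective (@memb K A).
Proof.
move=> a a' e; apply/eqP; rewrite -subr_eq0; apply/eqP/nondegr => b.
have := congr1 (fun x => mactl x b) e; rewrite /mactl /= => eb.
by rewrite -scaleN1r nmulDl nmulZl eb scaleN1r subrr.
Qed.

Lemma membK (K : fieldType) (A : ndalgType K) : cancel (@memb K A) (@munemb K A).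
Proof. by move=> a; apply: memb_inj; exact: (@xgetI _ 0 [set b | memb b = memb a]%classic a). Qed.

Lemma munembK (K : fieldType) (A : nualgType K) (x : mult A) :
  (exists a, memb a = x) -> memb (munemb x) = x.
Proof. by case=> a ax; exact: (@xgetI _ 0 [set b | memb b = x]%classic a). Qed.

Section Associator.
Variables (K : fieldType) (U V W : lmodType K).

(** The canonical identification of the two iterated tensor products. *)
Definition tassoc : (U ⊗ V) ⊗ W -> U ⊗ (V ⊗ W) :=
  tlift (fun (s : U ⊗ V) w => tlift (fun u v => u ⊗ (v ⊗ w)) s).

Lemma tassoc_bilin_in (w : W) : bilin (fun (u : U) (v : V) => u ⊗ (v ⊗ w)).
Proof.
by split=> [v|u] k x y; rewrite ?tpureDl ?tpureZl ?tpureDr ?tpureZr.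
Qed.

Lemma tassoc_bilin :
  bilin (fun (s : U ⊗ V) (w : W) => tlift (fun u v => u ⊗ (v ⊗ w)) s).
Proof.
split=> [w|s k w w']; first exact: tlift_linear (tassoc_bilin_in w).
elim/tensor_ind: s => [u v|s t es et].
  by rewrite !(tliftE (tassoc_bilin_in _)) !tpureDr !tpureZr.
have D w0 := linD (tlift_linear (tassoc_bilin_in w0)).
by rewrite !D es et scalerDr addrACA.
Qed.

Lemma tassocE (u : U) (v : V) (w : W) : tassoc ((u ⊗ v) ⊗ w) = u ⊗ (v ⊗ w).
Proof. by rewrite /tassoc (tliftE tassoc_bilin) (tliftE (tassoc_bilin_in w)). Qed.

End Associator.

(** [x] and [y] are the same multiplier when [A] is identified with [B] by [f]. *)
Definition mult_corr (K : fieldType) (A B : nualgType K) (f : A -> B)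
    (x : mult A) (y : mult B) : Prop :=
  (forall a, f (mactl x a) = mactl y (f a)) /\
  (forall a, f (mactr a x) = mactr (f a) y).

Definition alg_hom (K : fieldType) (A B : nualgType K) (f : A -> B) : Prop :=
  linear f /\ (forall a b, f (a * b)%g = (f a * f b)%g).

Definition alg_antihom (K : fieldType) (A B : nualgType K) (f : A -> B) : Prop :=
  linear f /\ (forall a b, f (a * b)%g = (f b * f a)%g).

(** * Multiplier Hopf group-coalgebras *)

Definition transport (I : Type) (P : I -> Type) (i j : I) (e : i = j) (x : P i) : P j :=
  ecast k (P k) e x.
Arguments transport {I} P {i j} e x.

Section GroupCoalgebra.
Variables (K : fieldType) (π : groupType) (A : π -> ndalgType K).
Variable Δ : forall α β : π, A (α * β)%g -> mult (A α ⊗ A β).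

(** The elements [Δ(a)(1 ⊗ b)] and [(a ⊗ 1)Δ(b)] of [M(A α ⊗ A β)]. *)
Definition mcov1 α β (a : A (α * β)%g) (b : A β) : mult (A α ⊗ A β) :=
  (Δ a * mtens (mult1 (A α)) (memb b))%g.
Definition mcov2 α β (a : A α) (b : A (α * β)%g) : mult (A α ⊗ A β) :=
  (mtens (memb a) (mult1 (A β)) * Δ b)%g.

(** The same elements in [A α ⊗ A β], to which they belong when [Δ] is a
    comultiplication. *)
Definition cov1 α β (a : A (α * β)%g) (b : A β) : A α ⊗ A β := munemb (mcov1 a b).
Definition cov2 α β (a : A α) (b : A (α * β)%g) : A α ⊗ A β := munemb (mcov2 a b).

Definition covered : Prop := forall α β : π,
  (forall (a : A (α * β)%g) (b : A β), exists t, memb t = mcov1 a b) /\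
  (forall (a : A α) (b : A (α * β)%g), exists t, memb t = mcov2 a b).

(** [Δ ⊗ I] and [I ⊗ Δ], with values in the multipliers of the threefold tensor
    product. *)
Definition comul_id α β γ : A (α * β)%g ⊗ A γ -> mult ((A α ⊗ A β) ⊗ A γ) :=
  tlift (fun x y => mtens (Δ x) (memb y)).
Definition id_comul α β γ : A α ⊗ A (β * γ)%g -> mult (A α ⊗ (A β ⊗ A γ)) :=
  tlift (fun x y => mtens (memb x) (Δ y)).

Definition coassociative : Prop :=
  forall (α β γ : π) (a : A α) (b : A (α * β * γ)%g) (c : A γ),
    mult_corr (@tassoc K (A α) (A β) (A γ))
      (mtens (mtens (memb a) (mult1 (A β))) (mult1 (A γ)) *
         comul_id (cov1 b c))%g
      (id_comul (cov2 a (transport A (esym (mulgA α β γ)) b)) *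
         mtens (mult1 (A α)) (mtens (mult1 (A β)) (memb c)))%g.

Definition comultiplication : Prop :=
  [/\ forall α β : π, alg_hom (@Δ α β), covered & coassociative].

Definition T1 α β : A (α * β)%g ⊗ A β -> A α ⊗ A β := tlift (@cov1 α β).
Definition T2 α β : A α ⊗ A (α * β)%g -> A α ⊗ A β := tlift (@cov2 α β).

Lemma cov1_bilin : comultiplication -> forall α β : π, bilin (@cov1 α β).
Proof.
move=> [hom cov _] α β; have [ΔL _] := hom α β; have [c1 _] := cov α β.
split=> [b k a a'|a k b b']; apply: memb_inj;
  rewrite (memb_linear k) !munembK //; rewrite /mcov1.
  by rewrite ΔL nmulDl nmulZl.
by rewrite memb_linear (mtens_bilin _ _).2 nmulDr nmulZr.
Qed.

Lemma cov2_bilin : comultiplication -> forall α β : π, bilin (@cov2 α β).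
Proof.
move=> [hom cov _] α β; have [ΔL _] := hom α β; have [_ c2] := cov α β.
split=> [b k a a'|a k b b']; apply: memb_inj;
  rewrite (memb_linear k) !munembK //; rewrite /mcov2.
  by rewrite memb_linear (mtens_bilin _ _).1 nmulDl nmulZl.
by rewrite ΔL nmulDr nmulZr.
Qed.

Definition multiplier_Hopf_coalgebra : Prop :=
  comultiplication /\
  (forall α β : π, bijective (@T1 α β) /\ bijective (@T2 α β)).

(** [K] being the base field, [A ⊗ K] and [K ⊗ A] are identified with [A]: thus
    [I ⊗ ε] is [x ⊗ y |-> ε y *: x] and [ε ⊗ I] is [x ⊗ y |-> ε x *: y]. *)
Definition counit (ε : A 1%g -> K) : Prop :=
  [/\ scalar ε, forall a b : A 1%g, ε (a * b)%g = ε a * ε b,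
      forall (α : π) (a b : A α),
        tlift (fun x y => ε y *: x) (cov2 a (transport A (esym (mulg1 α)) b)) =
        (a * b)%g
    & forall (α : π) (a b : A α),
        tlift (fun x y => ε x *: y) (cov1 (transport A (esym (mul1g α)) a) b) =
        (a * b)%g].

End GroupCoalgebra.

(** Multiplication of [A ⊗ M(B)] by [1 ⊗ b] on the right and of [M(A) ⊗ B] by
    [a ⊗ 1] on the left; the results lie in [A ⊗ B]. *)
Definition mulr_1tens (K : fieldType) (A B : nualgType K) (z : A ⊗ mult B) (b : B) :
  A ⊗ B := tmap id (fun x : mult B => mactl x b) z.
Definition mull_tens1 (K : fieldType) (A B : nualgType K) (a : A) (z : mult A ⊗ B) :
  A ⊗ B := tmap (fun x : mult A => mactr a x) id z.

(* Main.v *)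
(** Put [S(a)b = (ε ⊗ I) T1^-1 (a ⊗ b)] and [b S(a) = (I ⊗ ε) T2^-1 (b ⊗ a)].  The
    two antipode identities are then immediate, and [S] is antimultiplicative since
    [T1 (a x ⊗ y) = Δ(a) T1 (x ⊗ y)] and [ε] is multiplicative.  That the two formulas
    define a single multiplier follows from coassociativity in the form
    [(T2 ⊗ I)(I ⊗ T1) = (I ⊗ T1)(T2 ⊗ I)] and the injectivity of [T2]. *)

Require Import Defs.
From mathcomp Require Import all_boot all_algebra.
From mathcomp Require Import boolp classical_sets reals complex.

Import GRing.Theory.
Local Open Scope ring_scope.

Set Implicit Arguments.
Unset Strict Implicit.
Unset Printing Implicit Defensive.

(** * Inverses of bijective linear maps *)

Section LinearInverse.
Variables (K : fieldType) (U V : lmodType K).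

(** [bijective] is a proposition, so the inverse it asserts cannot be extracted as data. A preimage
    is chosen instead, with default value 0 outside the image. *)
Definition linv (f : U -> V) (v : V) : U := xget 0 [set u | f u = v]%classic.

Lemma linvK (f : U -> V) : bijective f -> cancel (linv f) f.
Proof.
by case=> g _ gK v; exact: (@xgetI _ 0 [set u | f u = v]%classic (g v)).
Qed.

Lemma linvKV (f : U -> V) : bijective f -> cancel f (linv f).
Proof. by move=> fb u; apply: (bij_inj fb); rewrite linvK. Qed.

Lemma linv_linear (f : U -> V) : linear f -> bijective f -> linear (linv f).
Proof. by move=> fL fb k x y; apply: (bij_inj fb); rewrite fL !linvK. Qed.

Lemma id_linear : linear (@id U). Proof. by []. Qed.

End LinearInverse.

Lemma comp_linear (K : fieldType) (U V W : lmodType K) (f : U -> V) (g : V -> W) :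
  linear f -> linear g -> linear (g \o f).
Proof. by move=> fL gL k x y; rewrite /= fL gL. Qed.

Lemma nmul_bilin (K : fieldType) (A : nualgType K) :
  bilin (fun a b : A => (a * b)%g).
Proof. by split=> [b|a]; [exact: nmulr_linear|exact: nmull_linear]. Qed.

(** * Maps between tensor products, and reassociation *)

Section TensorMaps.
Variables (K : fieldType).

Lemma tpurel_linear (U V : lmodType K) (v : V) : linear (fun u : U => u ⊗ v).
Proof. exact: (tpure_bilin U V).1. Qed.

Lemma tpurer_linear (U V : lmodType K) (u : U) : linear (fun v : V => u ⊗ v).
Proof. exact: (tpure_bilin U V).2. Qed.

Lemma tmap_inj (U V U' : lmodType K) (f : U -> U') :
  linear f -> bijective f -> injective (tmap f (@id V)).
Proof.
move=> fL fb; have gL := linv_linear fL fb; have iL := @id_linear K V.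
apply: (can_inj (g := tmap (linv f) id)).
apply: eq_tensor => [||u v] //.
- exact: comp_linear (tmap_linear fL iL) (tmap_linear gL iL).
- by rewrite !tmapE // linvKV.
Qed.

(** Linearity in the parameter of the map rather than in the tensor. This and [tmapr_linear] supply
    one half of the bilinearity of maps built with [tlift] whose value is itself a [tmap]. *)
Lemma tmapl_linear (U V U' V' : lmodType K) (f : V -> U -> U') (g : V' -> V') t :
  linear g -> (forall u, linear (f^~ u)) -> (forall v, linear (f v)) ->
  linear (fun x => tmap (f x) g t).
Proof.
move=> gL f1 f2 k x y; move: t; apply: eq_tensor => [||u v].
- exact: tmap_linear.
- move=> l s t; rewrite !(tmap_linear (f2 _) gL) !scalerDr !scalerA addrACA.
  by rewrite ![l * k]mulrC.
- by rewrite !tmapE // f1 tpureDl tpureZl.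
Qed.

Lemma tmapr_linear (U V U' V' : lmodType K) (f : V -> U -> U') (g : V' -> V') t :
  linear g -> (forall u, linear (f^~ u)) -> (forall v, linear (f v)) ->
  linear (fun x => tmap g (f x) t).
Proof.
move=> gL f1 f2 k x y; move: t; apply: eq_tensor => [||u v].
- exact: tmap_linear.
- move=> l s t; rewrite !(tmap_linear gL (f2 _)) !scalerDr !scalerA addrACA.
  by rewrite ![l * k]mulrC.
- by rewrite !tmapE // f1 tpureDr tpureZr.
Qed.

Section Assoc.
Variables (U V W : lmodType K).

Lemma tassoc_linear : linear (@tassoc K U V W).
Proof. exact: tlift_linear (tassoc_bilin U V W). Qed.

Definition tassocV : U ⊗ (V ⊗ W) -> (U ⊗ V) ⊗ W :=
  tlift (fun u t => tmap (tpure u) id t).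

Lemma tassocV_bilin : bilin (fun (u : U) (t : V ⊗ W) => tmap (tpure u) id t).
Proof.
split=> [t|u]; last by apply: tmap_linear; [exact: tpurer_linear|].
by apply: tmapl_linear => // v; [exact: tpurel_linear|exact: tpurer_linear].
Qed.

Lemma tassocV_linear : linear tassocV.
Proof. exact: tlift_linear tassocV_bilin. Qed.

Lemma tassocVE u v w : tassocV (u ⊗ (v ⊗ w)) = (u ⊗ v) ⊗ w.
Proof.
by rewrite /tassocV (tliftE tassocV_bilin) tmapE //; exact: tpurer_linear.
Qed.

Lemma tassocK : cancel (@tassoc K U V W) tassocV.
Proof.
apply: eq_tensor => [||s w] //.
  exact: comp_linear tassoc_linear tassocV_linear.
have aL : linear (fun s : U ⊗ V => tassocV (tassoc (s ⊗ w))).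
  exact: comp_linear (tpurel_linear w) (comp_linear tassoc_linear tassocV_linear).
move: s; apply: eq_tensor => // [|u v]; first exact: tpurel_linear.
by rewrite tassocE tassocVE.
Qed.

Lemma tassocVK : cancel tassocV (@tassoc K U V W).
Proof.
apply: eq_tensor => [||u t] //.
  exact: comp_linear tassocV_linear tassoc_linear.
have aL : linear (fun t : V ⊗ W => tassoc (tassocV (u ⊗ t))).
  exact: comp_linear (tpurer_linear u) (comp_linear tassocV_linear tassoc_linear).
move: t; apply: eq_tensor => // [|v w]; first exact: tpurer_linear.
by rewrite tassocVE tassocE.
Qed.

End Assoc.

Lemma tassocM (A B C : nualgType K) :
  {morph @tassoc K A B C : s t / (s * t)%g}.
Proof.
move=> s t.
have aD := linD (@tassoc_linear A B C).
elim/tensor_ind: s => [s c|s s' es es']; last by rewrite aD !nmulDl aD es es'.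
elim/tensor_ind: s => [a b|s s' es es'].
  elim/tensor_ind: t => [t c'|t t' et et']; last by rewrite aD !nmulDr aD et et'.
  elim/tensor_ind: t => [a' b'|t t' et et']; last first.
    by rewrite tpureDl aD !nmulDr aD et et'.
  by rewrite !tmul_pure !tassocE !tmul_pure.
by rewrite tpureDl aD !nmulDl aD es es'.
Qed.

End TensorMaps.

(** Since [tassoc] is surjective and multiplicative, comparing left actions gives
    [(tassoc s - t) u = 0] for every [u], and the threefold tensor product is nondegenerate. This
    turns coassociativity into an equation between tensors. *)
Lemma mult_corr_memb (K : fieldType) (A B C : ndalgType K)
    (s : (A ⊗ B) ⊗ C) (t : A ⊗ (B ⊗ C)) :
  mult_corr (@tassoc K A B C) (memb s) (memb t) -> tassoc s = t.
Proof.
case=> h _; apply/eqP; rewrite -subr_eq0; apply/eqP/nondegr => u.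
rewrite -scaleN1r nmulDl nmulZl -[u]tassocVK -tassocM.
by rewrite [tassoc (_ * _)%g]h scaleN1r subrr.
Qed.

(** * Actions and tensor products of multipliers *)

Section MultiplierActions.
Variables (K : fieldType).

Lemma mactl_linear (A : nualgType K) (x : mult A) : linear (mactl x).
Proof. by case: (multP x). Qed.

Lemma mactr_linear (A : nualgType K) (x : mult A) : linear ((@mactr K A)^~ x).
Proof. by case: (multP x). Qed.

Lemma memb_mactl (A : nualgType K) (x : mult A) (a : A) :
  memb (mactl x a) = (x * memb a)%g.
Proof.
have [_ _ xl _ xc] := multP x.
by apply: mult_eq => b; rewrite /mactl /mactr /= ?xl ?xc.
Qed.

Lemma memb_mactr (A : nualgType K) (x : mult A) (a : A) :
  memb (mactr a x) = (memb a * x)%g.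
Proof.
have [_ _ _ xr xc] := multP x.
by apply: mult_eq => b; rewrite /mactl /mactr /= ?xr ?xc.
Qed.

Lemma membM (A : nualgType K) : {morph @memb K A : a b / (a * b)%g}.
Proof. by move=> a b; apply: mult_eq => c; rewrite /mactl /mactr /= ?mulgA. Qed.

(** The left action determines the right one: [(b x) c = b (x c)] for all [c], and nondegeneracy
    recovers [b x]. *)
Lemma mult_eql (A : ndalgType K) (x y : mult A) : mactl x =1 mactl y -> x = y.
Proof.
move=> e; have [_ _ _ _ xc] := multP x; have [_ _ _ _ yc] := multP y.
apply: mult_eq => // b; apply/eqP; rewrite -subr_eq0; apply/eqP/nondegr => c.
rewrite -scaleN1r nmulDl nmulZl /mactr xc yc -/(mactl x c) e.
by rewrite scaleN1r subrr.
Qed.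

Section Tensor.
Variables (A B : nualgType K).

Lemma mtensM (x x' : mult A) (y y' : mult B) :
  (mtens x y * mtens x' y')%g = mtens (x * x')%g (y * y')%g.
Proof.
have [xL xR _ _ _] := multP x; have [yL yR _ _ _] := multP y.
have [x'L x'R _ _ _] := multP x'; have [y'L y'R _ _ _] := multP y'.
apply: mult_eq; apply: eq_tensor => [||a b].
1, 2, 4, 5: by move=> k s t; rewrite (mactl_linear, mactr_linear).
- rewrite /mactl /=.
  by rewrite !tmapE //; apply: comp_linear.
- rewrite /mactr /=.
  by rewrite !tmapE //; apply: comp_linear.
Qed.

Lemma mtens_memb (a : A) (b : B) : mtens (memb a) (memb b) = memb (a ⊗ b).
Proof.
apply: mult_eq; apply: eq_tensor => [||a' b'].
1, 2, 4, 5: by move=> k s t; rewrite (mactl_linear, mactr_linear).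
- by rewrite /mactl /= tmapE ?tmul_pure //; exact: nmull_linear.
- by rewrite /mactr /= tmapE ?tmul_pure //; exact: nmulr_linear.
Qed.

Lemma mult1M (x : mult A) : (mult1 A * x)%g = x.
Proof. exact: mult_eq. Qed.

Lemma multM1 (x : mult A) : (x * mult1 A)%g = x.
Proof. exact: mult_eq. Qed.

End Tensor.
End MultiplierActions.

(** * The maps T1 and T2, coassociativity and the counit on tensors *)

Section Antipode.
Variables (K : fieldType) (π : groupType) (A : π -> ndalgType K).
Variable Δ : forall α β : π, A (α * β)%g -> mult (A α ⊗ A β).
Hypothesis hΔ : multiplier_Hopf_coalgebra Δ.

(* The index [p] is only propositionally [α * β], so that [A 1] can stand for
   [A (α * α^-1)] and [A α] for [A (α * 1)] without explicit transports. *)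
Section Covers.
Variables (p α β : π) (e : p = (α * β)%g).

Definition dcomul (a : A p) : mult (A α ⊗ A β) := Δ (transport A e a).
Definition dcov1 (a : A p) (b : A β) : A α ⊗ A β := cov1 Δ (transport A e a) b.
Definition dcov2 (a : A α) (b : A p) : A α ⊗ A β := cov2 Δ a (transport A e b).
Definition dT1 : A p ⊗ A β -> A α ⊗ A β := tlift dcov1.
Definition dT2 : A α ⊗ A p -> A α ⊗ A β := tlift dcov2.

Lemma dcomulM a b : dcomul (a * b)%g = (dcomul a * dcomul b)%g.
Proof.
(* Eliminating [esym e] replaces [p] by [α * β]. The leftover loop [e'] is [erefl], since equality
   on [π] is decidable. *)
rewrite /dcomul; case: _ / (esym e) (e) a b => e' a b.
rewrite (eq_irrelevance e' erefl) /=.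
by have [[h _ _] _] := hΔ; case: (h α β) => _ ->.
Qed.

Lemma memb_dcov1 a b :
  memb (dcov1 a b) = (dcomul a * mtens (mult1 (A α)) (memb b))%g.
Proof. by have [[_ h _] _] := hΔ; rewrite munembK //; have [+ _] := h α β; apply. Qed.

Lemma memb_dcov2 a b :
  memb (dcov2 a b) = (mtens (memb a) (mult1 (A β)) * dcomul b)%g.
Proof. by have [[_ h _] _] := hΔ; rewrite munembK //; have [_] := h α β; apply. Qed.

Lemma dcov1_bilin : bilin dcov1.
Proof.
rewrite /dcov1; case: _ / (esym e) (e) => e'.
by rewrite (eq_irrelevance e' erefl); apply: cov1_bilin; case: hΔ.
Qed.

Lemma dcov2_bilin : bilin dcov2.
Proof.
rewrite /dcov2; case: _ / (esym e) (e) => e'.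
by rewrite (eq_irrelevance e' erefl); apply: cov2_bilin; case: hΔ.
Qed.

Lemma dT1_linear : linear dT1. Proof. exact: tlift_linear dcov1_bilin. Qed.
Lemma dT2_linear : linear dT2. Proof. exact: tlift_linear dcov2_bilin. Qed.

Lemma dT1E a b : dT1 (a ⊗ b) = dcov1 a b. Proof. exact: tliftE dcov1_bilin _ _. Qed.
Lemma dT2E a b : dT2 (a ⊗ b) = dcov2 a b. Proof. exact: tliftE dcov2_bilin _ _. Qed.

Lemma dT1_bij : bijective dT1.
Proof.
rewrite /dT1 /dcov1; case: _ / (esym e) (e) => e'.
by rewrite (eq_irrelevance e' erefl); case: hΔ => _ /(_ α β)[].
Qed.

Lemma dT2_bij : bijective dT2.
Proof.
rewrite /dT2 /dcov2; case: _ / (esym e) (e) => e'.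
by rewrite (eq_irrelevance e' erefl); case: hΔ => _ /(_ α β)[].
Qed.

(** This is Δ(a)(1 ⊗ c)(1 ⊗ b) = Δ(a)(1 ⊗ cb). It makes [antil a] commute with right multiplication;
    [dT2_mull] does the same for [antir] on the left. *)
Lemma dT1_mulr s b :
  dT1 (tmap id (fun y => (y * b)%g) s) = tmap id (fun y => (y * b)%g) (dT1 s).
Proof.
have bL : linear (tmap (@id (A α)) (fun y : A β => (y * b)%g)).
  by apply: tmap_linear => //; exact: nmulr_linear.
move: s; apply: eq_tensor => [||a c].
- by apply: comp_linear dT1_linear; apply: tmap_linear => //; exact: nmulr_linear.
- exact: comp_linear dT1_linear bL.
rewrite (tmapE (@id_linear _ _) (nmulr_linear b)) !dT1E.
have -> t : tmap id (fun y : A β => (y * b)%g) t =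
    mactr t (mtens (mult1 (A α)) (memb b)) by [].
by apply: memb_inj; rewrite memb_mactr !memb_dcov1 -mulgA mtensM mult1M membM.
Qed.

Lemma dT2_mull s b :
  dT2 (tmap (fun x => (b * x)%g) id s) = tmap (fun x => (b * x)%g) id (dT2 s).
Proof.
have bL : linear (tmap (fun x : A α => (b * x)%g) (@id (A β))).
  by apply: tmap_linear => //; exact: nmull_linear.
move: s; apply: eq_tensor => [||c a].
- by apply: comp_linear dT2_linear; apply: tmap_linear => //; exact: nmull_linear.
- exact: comp_linear dT2_linear bL.
rewrite (tmapE (nmull_linear b) (@id_linear _ _)) !dT2E.
have -> t : tmap (fun x : A α => (b * x)%g) id t =
    mactl (mtens (memb b) (mult1 (A β))) t by [].
by apply: memb_inj; rewrite memb_mactl !memb_dcov2 mulgA mtensM mult1M membM.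
Qed.

(** Multiplicativity of Δ gives Δ(ax)(1 ⊗ y) = Δ(a)Δ(x)(1 ⊗ y). *)
Lemma dT1_comul (a : A p) u :
  dT1 (tmap (fun x => (a * x)%g) id u) = mactl (dcomul a) (dT1 u).
Proof.
move: u; apply: eq_tensor => [||x y].
- by apply: comp_linear dT1_linear; apply: tmap_linear => //; exact: nmull_linear.
- exact: comp_linear dT1_linear (mactl_linear _).
rewrite (tmapE (nmull_linear a) (@id_linear _ _)) !dT1E.
by apply: memb_inj; rewrite memb_mactl !memb_dcov1 dcomulM mulgA.
Qed.

(** The multipliers 1 ⊗ c and b ⊗ 1 commute, with product b ⊗ c. *)
Lemma dcov1_mulr (a : A p) (c : A β) (b : A α) :
  tmap (fun x => (x * b)%g) id (dcov1 a c) = mactl (dcomul a) (b ⊗ c).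
Proof.
have -> t : tmap (fun x : A α => (x * b)%g) id t =
    mactr t (mtens (memb b) (mult1 (A β))) by [].
apply: memb_inj; rewrite memb_mactl memb_mactr memb_dcov1 -mulgA mtensM.
by rewrite mult1M multM1 mtens_memb.
Qed.

End Covers.

(** Both multipliers compared in [coassociative] come from elements of the threefold tensor
    products: multiplying by a ⊗ 1 ⊗ 1 turns Δ ⊗ I into T2(a ⊗ -) ⊗ I, and multiplying by 1 ⊗ 1 ⊗ c
    turns I ⊗ Δ into I ⊗ T1(- ⊗ c). *)
Lemma dcoassoc p q r α β γ (ep : p = (α * β)%g) (eq' : q = (β * γ)%g)
    (er : r = (p * γ)%g) (er' : r = (α * q)%g) (a : A α) (b : A r) (c : A γ) :
  tassoc (tmap (dcov2 ep a) id (dcov1 er b c)) =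
  tmap id (fun y => dcov1 eq' y c) (dcov2 er' a b).
Proof.
subst p q r; rewrite (eq_irrelevance er' (esym (mulgA α β γ))).
have [[_ _ h] _] := hΔ; have := h α β γ a b c.
have c1L := (dcov1_bilin (erefl (β * γ)%g)).1 c.
have c2L := (dcov2_bilin (erefl (α * β)%g)).2 a.
rewrite /comul_id /id_comul -/(dcov1 erefl b c) -/(dcov2 _ a b).
have B1 : bilin (fun (x : A (α * β)%g) (y : A γ) => mtens (Δ x) (memb y)).
  have [[/(_ α β)[ΔL _] _ _] _] := hΔ.
  split=> [y|x] k u v; first by rewrite ΔL (mtens_bilin _ _).1.
  by rewrite memb_linear (mtens_bilin _ _).2.
have B2 : bilin (fun (x : A α) (y : A (β * γ)%g) => mtens (memb x) (Δ y)).
  have [[/(_ β γ)[ΔL _] _ _] _] := hΔ.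
  split=> [y|x] k u v; last by rewrite ΔL (mtens_bilin _ _).2.
  by rewrite memb_linear (mtens_bilin _ _).1.
have -> : forall t, (mtens (mtens (memb a) (mult1 (A β))) (mult1 (A γ)) *
    tlift (fun x y => mtens (Δ x) (memb y)) t)%g =
    memb (tmap (dcov2 erefl a) id t).
  apply: eq_tensor => [||x y].
  - exact: comp_linear (tlift_linear B1) (nmull_linear _).
  - exact: comp_linear (tmap_linear c2L (@id_linear _ _)) (@memb_linear _ _).
  - by rewrite (tliftE B1) mtensM mult1M tmapE // -mtens_memb memb_dcov2.
have -> : forall t, (tlift (fun x y => mtens (memb x) (Δ y)) t *
    mtens (mult1 (A α)) (mtens (mult1 (A β)) (memb c)))%g =
    memb (tmap id (fun y => dcov1 erefl y c) t).
  apply: eq_tensor => [||x y].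
  - exact: comp_linear (tlift_linear B2) (nmulr_linear _).
  - exact: comp_linear (tmap_linear (@id_linear _ _) c1L) (@memb_linear _ _).
  - by rewrite (tliftE B2) mtensM multM1 tmapE // -mtens_memb memb_dcov1.
exact: mult_corr_memb.
Qed.

Variable ε : A 1%g -> K.
Hypothesis hε : counit Δ ε.

Let εL : scalar ε. Proof. by case: hε. Qed.

Lemma counit_dT1 α (e : α = (1 * α)%g) t : slicel ε (dT1 e t) = mulmap t.
Proof.
have mB := nmul_bilin (A α).
move: t; apply: eq_tensor => [||a b].
- exact: comp_linear (dT1_linear e) (slicel_linear εL).
- exact: tlift_linear.
rewrite dT1E /mulmap (tliftE mB) -[RHS](let: And4 _ _ _ h := hε in h α a b).
by rewrite /dcov1 (eq_irrelevance e (esym (mul1g α))).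
Qed.

Lemma counit_dT2 α (e : α = (α * 1)%g) t : slicer ε (dT2 e t) = mulmap t.
Proof.
have mB := nmul_bilin (A α).
move: t; apply: eq_tensor => [||a b].
- exact: comp_linear (dT2_linear e) (slicer_linear εL).
- exact: tlift_linear.
rewrite dT2E /mulmap (tliftE mB) -[RHS](let: And4 _ _ h _ := hε in h α a b).
by rewrite /dcov2 (eq_irrelevance e (esym (mulg1 α))).
Qed.

(** * The antipode as a multiplier, and its antimultiplicativity *)

Section AntipodeMultiplier.
Variables (α g : π) (el : 1%g = (g * α)%g) (er : 1%g = (α * g)%g).

(** The left action S(a)b, while [antir] is the right action bS(a). Here [g] is the inverse of [α],
    known only through [el] and [er], so that the construction also applies to the pair (α^-1, α)
    with values directly over [A α]. *)
Definition antil (a : A α) (b : A g) : A g := slicel ε (linv (dT1 er) (a ⊗ b)).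
Definition antir (a : A α) (b : A g) : A g := slicer ε (linv (dT2 el) (b ⊗ a)).

Let vL1 := linv_linear (dT1_linear er) (dT1_bij er).
Let vL2 := linv_linear (dT2_linear el) (dT2_bij el).

Lemma antil_bilin : bilin antil.
Proof.
split=> [b|a].
  exact: comp_linear (comp_linear (tpurel_linear b) vL1) (slicel_linear εL).
exact: comp_linear (comp_linear (tpurer_linear a) vL1) (slicel_linear εL).
Qed.

Lemma antir_bilin : bilin antir.
Proof.
split=> [b|a].
  exact: comp_linear (comp_linear (tpurer_linear b) vL2) (slicer_linear εL).
exact: comp_linear (comp_linear (tpurel_linear a) vL2) (slicer_linear εL).
Qed.

Lemma slicel_mulr s (b : A g) :
  slicel ε (tmap (@id (A 1%g)) (fun y => (y * b)%g) s) = (slicel ε s * b)%g.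
Proof.
have bL := tmap_linear (@id_linear _ (A 1%g)) (nmulr_linear b).
move: s; apply: eq_tensor => [||x y].
- exact: comp_linear bL (slicel_linear εL).
- exact: comp_linear (slicel_linear εL) (nmulr_linear b).
- by rewrite (tmapE (@id_linear _ _) (nmulr_linear b)) !slicelE // nmulZl.
Qed.

Lemma slicer_mull s (b : A g) :
  slicer ε (tmap (fun x => (b * x)%g) (@id (A 1%g)) s) = (b * slicer ε s)%g.
Proof.
have bL := tmap_linear (nmull_linear b) (@id_linear _ (A 1%g)).
move: s; apply: eq_tensor => [||x y].
- exact: comp_linear bL (slicer_linear εL).
- exact: comp_linear (slicer_linear εL) (nmull_linear b).
- by rewrite (tmapE (nmull_linear b) (@id_linear _ _)) !slicerE // nmulZr.
Qed.

Lemma antil_mulr a b c : antil a (b * c)%g = (antil a b * c)%g.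
Proof.
rewrite /antil -slicel_mulr; congr slicel.
apply: (bij_inj (dT1_bij er)); rewrite dT1_mulr !(linvK (dT1_bij er)).
by rewrite (tmapE (@id_linear _ _) (nmulr_linear c)).
Qed.

Lemma antir_mull a b c : antir a (b * c)%g = (b * antir a c)%g.
Proof.
rewrite /antir -slicer_mull; congr slicer.
apply: (bij_inj (dT2_bij el)); rewrite dT2_mull !(linvK (dT2_bij el)).
by rewrite (tmapE (nmull_linear b) (@id_linear _ _)).
Qed.

(* Both sides are read off the preimage of [c ⊗ a ⊗ b] under [T2 ⊗ I] (up to
   reassociation, [ψ]) by applying [ε] to its middle leg and multiplying the outer
   ones ([φ]).  This preimage is [t ⊗ b]; by coassociativity it is also
   [θ s], where [θ s = (I ⊗ T1) (T2^-1 ⊗ I) (c ⊗ s)]. *)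
Lemma slice_compat (a : A α) (b c : A g) (s : A 1%g ⊗ A g) (t : A g ⊗ A 1%g) :
  dT1 er s = a ⊗ b -> dT2 el t = c ⊗ a ->
  (c * slicel ε s = slicer ε t * b)%g.
Proof.
move=> sE tE.
have e1 : g = (1 * g)%g by rewrite mul1g.
have e2 : g = (g * 1)%g by rewrite mulg1.
have iL (U : lmodType K) := @id_linear K U.
have c1L b' := (dcov1_bilin e1).1 b'.
have mL a' := tmap_linear (iL (A g)) (c1L a').
have vL := linv_linear (dT2_linear e2) (dT2_bij e2).
pose θ0 a' b' := tmap id (fun d => dcov1 e1 d b') (linv (dT2 e2) (c ⊗ a')).
have θB : bilin θ0.
  split=> [b'|a'].
    exact: comp_linear (comp_linear (tpurer_linear c) vL) (mL b').
  by apply: tmapr_linear => // d; exact: (dcov1_bilin e1).2.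
pose θ := tlift θ0; have θL : linear θ := tlift_linear θB.
have T2iL : linear (tmap (dT2 el) (@id (A g))) by exact: tmap_linear (dT2_linear el) _.
pose ψ := @tassoc _ _ _ _ \o tmap (dT2 el) id \o @tassocV _ (A g) (A 1%g) (A g).
have ψL : linear ψ.
  exact: comp_linear (@tassocV_linear _ _ _ _)
    (comp_linear T2iL (@tassoc_linear _ _ _ _)).
have ψθ s' : ψ (θ s') = c ⊗ dT1 er s'.
  move: s'; apply: eq_tensor => [||a' b'].
  - exact: comp_linear θL ψL.
  - exact: comp_linear (dT1_linear er) (tpurer_linear c).
  rewrite /θ (tliftE θB) /θ0 dT1E.
  have -> : c ⊗ dcov1 er a' b' = tmap id (fun y => dcov1 er y b') (c ⊗ a').
    by rewrite (tmapE (iL _) ((dcov1_bilin er).1 b')).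
  (* Once [c ⊗ a'] is written as T2 of its preimage, both sides are linear in that preimage. It may
     thus be taken to be [x ⊗ d], where coassociativity applies. *)
  rewrite -{2}[c ⊗ a'](linvK (dT2_bij e2)); move: (linv _ _).
  apply: eq_tensor => [||x d].
  - exact: comp_linear (mL b') ψL.
  - exact: comp_linear (dT2_linear e2) (tmap_linear (iL _) ((dcov1_bilin er).1 b')).
  rewrite (tmapE (iL _) (c1L b')) dT2E -(dcoassoc el er e1 e2) /ψ; congr tassoc.
  move: (dcov1 _ _ _); apply: eq_tensor => [||u v].
  - exact: comp_linear (tpurer_linear x) (comp_linear (@tassocV_linear _ _ _ _) T2iL).
  - exact: tmap_linear ((dcov2_bilin el).2 x) (iL _).
  by rewrite tassocVE !tmapE ?dT2E //; [exact: (dcov2_bilin el).2|exact: dT2_linear].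
have θE : tassocV (θ s) = t ⊗ b.
  (* T2 ⊗ I is injective, and both sides are sent to c ⊗ a ⊗ b: the right one by the choice of [t],
     the left one by [ψθ] and the choice of [s]. *)
  apply: (tmap_inj (dT2_linear el) (dT2_bij el)).
  apply: (can_inj (@tassocK _ _ _ _)).
  by rewrite (tmapE (dT2_linear el) (iL _)) tE tassocE -sE; exact: ψθ.
pose φ0 (x : A g) (v : A 1%g ⊗ A g) : A g := (x * slicel ε v)%g.
have φB : bilin φ0.
  split=> [v|x]; first exact: nmulr_linear.
  exact: comp_linear (slicel_linear εL) (nmull_linear x).
pose φ := tlift φ0; have φL : linear φ := tlift_linear φB.
have φθ s' : φ (θ s') = (c * slicel ε s')%g.
  move: s'; apply: eq_tensor => [||a' b'].
  - exact: comp_linear θL φL.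
  - exact: comp_linear (slicel_linear εL) (nmull_linear c).
  (* The right side is rewritten as (I ⊗ ε)(c ⊗ a') times b', so that (I ⊗ ε)T2 = m applies. On a
     pure tensor [x ⊗ d] of the preimage, (ε ⊗ I)T1 = m leaves x(db') = (xd)b'. *)
  rewrite /θ (tliftE θB) /θ0 slicelE // nmulZr -nmulZl -slicerE //.
  rewrite -{2}[c ⊗ a'](linvK (dT2_bij e2)) counit_dT2; move: (linv _ _).
  have mulB := nmul_bilin (A g).
  apply: eq_tensor => [||x d].
  - exact: comp_linear (mL b') φL.
  - exact: comp_linear (tlift_linear mulB) (nmulr_linear b').
  rewrite (tmapE (iL _) (c1L b')) /φ (tliftE φB) /φ0 -dT1E counit_dT1.
  by rewrite /mulmap !(tliftE mulB) mulgA.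
rewrite -φθ -[θ s]tassocVK θE.
move: t {tE θE}; apply: eq_tensor => [||x y].
- exact: comp_linear (tpurel_linear b) (comp_linear (@tassoc_linear _ _ _ _) φL).
- exact: comp_linear (slicer_linear εL) (nmulr_linear b).
by rewrite tassocE /φ (tliftE φB) /φ0 slicelE // slicerE // nmulZr nmulZl.
Qed.

Lemma antipode_subproof a : is_mult (antil a, antir a).
Proof.
split=> /= [||b c|b c|b c].
- exact: antil_bilin.2.
- exact: antir_bilin.2.
- exact: antil_mulr.
- exact: antir_mull.
- symmetry; apply: (@slice_compat a).
  + exact: linvK (dT1_bij er) _.
  + exact: linvK (dT2_bij el) _.
Qed.

Definition antipode (a : A α) : mult (A g) := mkmult (antipode_subproof a).

(** By [mult_eql] it suffices to compare left actions on [c]. If a ⊗ c is a sum of terms T1(x ⊗ y),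
    then ab ⊗ c is the sum of the Δ(x)(b ⊗ y) = T1(x T1^-1(b ⊗ y)), with [x] acting on the first
    leg. Since ε is multiplicative, S(ab)c is the sum of the ε(x) S(b)y, which is S(b)S(a)c. *)
Lemma antipode_antihom : alg_antihom antipode.
Proof.
split=> [k a b|a b]; apply: mult_eql => c; first exact: antil_bilin.1.
rewrite [LHS](_ : _ = antil (a * b)%g c) // [RHS](_ : _ = antil b (antil a c)) //.
rewrite /(antil (a * b)%g) /(antil a).
have -> : (a * b)%g ⊗ c = tmap (fun x => (x * b)%g) id (a ⊗ c).
  by rewrite (tmapE (nmulr_linear b) (@id_linear _ _)).
rewrite -{1}[a ⊗ c](linvK (dT1_bij er)); move: (linv (dT1 er) (a ⊗ c)).
have bL := tmap_linear (nmulr_linear b) (@id_linear _ (A g)).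
apply: eq_tensor => [||x y].
- exact: comp_linear (dT1_linear er)
    (comp_linear bL (comp_linear vL1 (slicel_linear εL))).
- exact: comp_linear (slicel_linear εL) (antil_bilin.2 b).
rewrite dT1E dcov1_mulr slicelE // (linZ _ (antil_bilin.2 b)).
rewrite -[b ⊗ y](linvK (dT1_bij er)) -dT1_comul (linvKV (dT1_bij er)).
rewrite /antil; move: (linv _ _).
have xL := tmap_linear (nmull_linear x) (@id_linear _ (A g)).
apply: eq_tensor => [||u v].
- exact: comp_linear xL (slicel_linear εL).
- by move=> k s t; rewrite (slicel_linear εL) scalerDr !scalerA mulrC.
rewrite (tmapE (nmull_linear x) (@id_linear _ _)) !slicelE //.
by case: hε => _ -> _ _; rewrite scalerA.
Qed.

(** On a pure tensor this is the multiplier law (cS(x))y = c(S(x)y). For [t] = T1(a ⊗ b) the inverse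
    cancels, which yields an antipode identity; [antipode_slicer] is the mirror image for T2. *)
Lemma antipode_slicel t (c : A g) :
  mulmap (mull_tens1 c (tmap antipode id t)) = (c * slicel ε (linv (dT1 er) t))%g.
Proof.
have aL := antipode_antihom.1; have iL := @id_linear K (A g).
have mB := nmul_bilin (A g).
move: t; apply: eq_tensor => [||x y].
- have cL : linear (fun x : mult (A g) => mactr c x) by [].
  exact: comp_linear (tmap_linear aL iL)
    (comp_linear (tmap_linear cL iL) (tlift_linear mB)).
- exact: comp_linear (comp_linear vL1 (slicel_linear εL)) (nmull_linear c).
rewrite (tmapE aL (@id_linear _ _)) /mull_tens1 tmapE // /mulmap (tliftE mB).
by have [_ _ _ _ h] := multP (antipode x); exact: h.
Qed.

Lemma antipode_slicer t (b : A g) :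
  mulmap (mulr_1tens (tmap id antipode t) b) = (slicer ε (linv (dT2 el) t) * b)%g.
Proof.
have aL := antipode_antihom.1; have iL := @id_linear K (A g).
have mB := nmul_bilin (A g).
move: t; apply: eq_tensor => [||x y].
- have bL : linear (fun x : mult (A g) => mactl x b) by [].
  exact: comp_linear (tmap_linear iL aL)
    (comp_linear (tmap_linear iL bL) (tlift_linear mB)).
- exact: comp_linear (comp_linear vL2 (slicer_linear εL)) (nmulr_linear b).
rewrite (tmapE (@id_linear _ _) aL) /mulr_1tens tmapE // /mulmap (tliftE mB).
by have [_ _ _ _ h] := multP (antipode y); symmetry; exact: h.
Qed.

End AntipodeMultiplier.

(** Applied to [invgK], this absorbs the transport from (α^-1)^-1 to α in the antipode
    identities. *)
Lemma antipode_transport α g g' (e : g = g')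
    (el : 1%g = (g * α)%g) (er : 1%g = (α * g)%g)
    (el' : 1%g = (g' * α)%g) (er' : 1%g = (α * g')%g) (x : A α) :
  transport (fun β : π => mult (A β)) e (antipode el er x) = antipode el' er' x.
Proof.
by subst g'; rewrite (eq_irrelevance el el') (eq_irrelevance er er').
Qed.

End Antipode.

Theorem theorem2 (R : realType) (π : groupType) (A : π -> ndalgType R[i])
    (Δ : forall α β : π, A (α * β)%g -> mult (A α ⊗ A β))
    (hΔ : multiplier_Hopf_coalgebra Δ)
    (ε : A 1%g -> R[i]) (hε : counit Δ ε) :
  exists S : forall α : π, A α -> mult (A (α^-1)%g),
    (forall α : π, alg_antihom (S α)) /\
    forall (α : π) (a : A 1%g) (b c : A α),
      let S' : A (α^-1)%g -> mult (A α) := fun x =>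
        transport (fun β : π => mult (A β)) (invgK α) (S (α^-1)%g x) in
      mulmap (mulr_1tens
        (tmap id S' (cov2 Δ c (transport A (esym (mulgV α)) a))) b)
        = ε a *: (c * b)%g
      /\
      mulmap (mull_tens1 c
        (tmap S' id (cov1 Δ (transport A (esym (mulVg α)) a) b)))
        = ε a *: (c * b)%g.
Proof.
have [εL _ _ _] := hε.
exists (fun α => antipode hΔ hε (esym (mulVg α)) (esym (mulgV α))).
split=> [α|α a b c S']; first exact: antipode_antihom.
have -> : S' = antipode hΔ hε (esym (mulgV α)) (esym (mulVg α)).
  by apply/funext => x; exact: antipode_transport.
split.
(* The tensor is T2(c ⊗ a), and slicing its preimage c ⊗ a by ε gives ε(a)c. *)
- rewrite antipode_slicer -/(dcov2 Δ (esym (mulgV α)) c a) -(dT2E hΔ).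
  by rewrite (linvKV (dT2_bij hΔ _)) slicerE // nmulZl.
- rewrite antipode_slicel -/(dcov1 Δ (esym (mulVg α)) a b) -(dT1E hΔ).
  by rewrite (linvKV (dT1_bij hΔ _)) slicelE // nmulZr.
Qed.
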